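(* (i) If $c<0.3250121326$ and $p=e^{-cn}$, then with high probability $\mathcal{P}(n,p)$ is $(\mathcal{P}(2),2)$-Ramsey. (ii) If $c>0.3289037391$ and $p=e^{-cn}$, then with high probability $\mathcal{P}(n,p)$ is not $(\mathcal{P}(2),2)$-Ramsey.
   Context: $\mathcal{P}(n)$ is the power set of $[n]$ ordered by inclusion; $\mathcal{P}(2)$ is thus the 4-element ''diamond'' poset. $\mathcal{P}(n,p)$ is the random subposet of $\mathcal{P}(n)$ (with inclusion order) obtained by keeping each element of $\mathcal{P}(n)$ independently with probability $p$. A poset $R$ contains a copy of a poset $F$ if there is an injective map $\phi:F\to R$ with $x\le_F y\Rightarrow \phi(x)\le_R\phi(y)$. A poset $R$ is $(F,2)$-Ramsey if every colouring of the elements of $R$ with 2 colours yields a copy of $F$ all of whose elements have the same colour. ''With high probability'' means with probability tending to 1 as $n\to\infty$. *)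

(* Defs.v *)
From HB Require Import structures.
From mathcomp Require Import all_boot all_order all_algebra.
From mathcomp Require Import all_classical all_reals all_analysis.

Set Implicit Arguments.
Unset Strict Implicit.
Unset Printing Implicit Defensive.

Import Order.TTheory GRing.Theory Num.Theory.
Import numFieldNormedType.Exports.
(* Makes {set T} a poset for inclusion; P(n) is then {set 'I_n}. *)
Import Order.DefaultSetSubsetOrder.

Local Open Scope classical_set_scope.
Local Open Scope ring_scope.

(* Only order preservation is required, not order reflection: copies are weak
   (not necessarily induced). *)
Definition is_copy d d' (F : porderType d) (R : porderType d') (phi : F -> R)
  : Prop :=
  injective phi /\ {homo phi : x y / (x <= y)%O}.

Definition ramsey d d' (F : porderType d) (R : porderType d') (r : nat)
  : Prop :=
  forall chi : R -> 'I_r,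
    exists2 phi : F -> R, is_copy phi & exists i : 'I_r, forall x : F,
      chi (phi x) = i.

Definition subposet d (P : finPOrderType d) (S : {set P}) : Type :=
  {x : P | x \in S}.
HB.instance Definition _ d (P : finPOrderType d) (S : {set P}) :=
  SubFinite.copy (subposet S) {x : P | x \in S}.
HB.instance Definition _ d (P : finPOrderType d) (S : {set P}) :=
  [SubChoice_isSubPOrder of subposet S by <: with d].

(* Probability of the event E for the random subset of T that contains each
   element of T independently with probability p; meaningful for 0 <= p <= 1. *)
Definition random_subset_prob (R : realType) (T : finType) (p : R)
    (E : {set T} -> Prop) : R :=
  \sum_(S : {set T} | `[< E S >])
    \prod_(x : T) (if x \in S then p else 1 - p).

(* E n is an event for the random poset P(n, p n). *)
Definition whp (R : realType) (p : nat -> R)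
    (E : forall n : nat, {set {set 'I_n}} -> Prop) : Prop :=
  random_subset_prob (p n) (E n) @[n --> \oo] --> (1 : R).

(* decimal [:: d1; ...; dk] is 0.d1...dk in base ten; long numeric literals
   are avoided because they are parsed as unary natural numbers. *)
Definition decimal (R : realType) (s : seq nat) : R :=
  foldr (fun d x => (d%:R + x) / 10) 0 s.

Lemma random_subset_prob_sup (R : realType) (T : finType) (p : R)
    (A : {set T}) :
  random_subset_prob p (fun S => A \subset S) = p ^+ #|A|.
Proof.
pose F (x : T) (b : bool) : R :=
  if b then p else if x \in A then 0 else 1 - p.
have -> : p ^+ #|A| = \prod_x \sum_b F x b.
  rewrite -prodr_const [RHS](bigID (mem A)) /= [X in _ = _ * X]big1 => [|x xA].
    rewrite mulr1; apply: eq_bigr => x xA.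
    by rewrite big_bool /F /= xA addr0.
  by rewrite big_bool /F /= (negbTE xA) addrC subrK.
rewrite bigA_distr_bigA /= /random_subset_prob big_mkcond /=.
rewrite (reindex (fun f : {ffun T -> bool} => [set x | f x]%SET)) /=; last first.
  exists (fun S : {set T} => [ffun x => x \in S]) => [f|S] _.
    by apply/ffunP => x; rewrite ffunE inE.
  by apply/setP => x; rewrite inE ffunE.
apply: eq_bigr => f _; rewrite asboolb; case: ifPn => [sA|].
  apply: eq_bigr => x _; rewrite inE /F; case: ifPn => // fx.
  by case: ifPn => // /(fintype.subsetP sA); rewrite inE (negbTE fx).
case/fintype.subsetPn => x xA; rewrite inE => fx.
by rewrite (bigD1 x) //= /F (negbTE fx) xA mul0r.
Qed.

Lemma random_subset_prob_total (R : realType) (T : finType) (p : R) :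
  random_subset_prob p (fun _ : {set T} => True) = 1.
Proof.
rewrite -[RHS](expr0 p) -(@cards0 T) -random_subset_prob_sup.
by apply: eq_bigl => S; rewrite finset.sub0set !asboolT.
Qed.

(* Main.v *)
From Stdlib Require Import ZArith.
Require Import Defs.
From mathcomp Require Import all_boot all_order all_algebra.
From mathcomp Require Import all_classical all_reals all_analysis.
From mathcomp Require Import ssrZ zify ring lra.
Import Order.TTheory GRing.Theory Num.Theory.
Import Order.DefaultSetSubsetOrder.
Import numFieldNormedType.Exports.
Local Open Scope ring_scope.
Set Implicit Arguments.
Unset Strict Implicit.

(** Write [N(F)] for the number of up-sets of a poset [F]; maps [F -> P(n)] preserving
    the order correspond to the words of length [n] over the up-sets of [F].

    Non-Ramsey part. Colour an element according to whether it is the top of a diamond.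
    A monochromatic diamond then has a bottom which is itself the top of a diamond, so
    there are [x < a, b < u < d, e < y] in the random poset. Given [x] and [y], with
    [g = |y \ x|], the expected number of such configurations is at most [8^g p^7], and
    they exist with probability at most [p^2]. Hence the probability of finding one
    somewhere is at most
    [sum_(x <= y) p^(2 + 5 th) 8^(th g) = (p^(2 + 5 th) (2 + 8^th))^n] for each [th] in
    [0, 1], and the best [th] gives the constant 0.3289037391.

    Ramsey part. Take [x < a, b < u < d, e < y] again, and add [p < q, r] between [x] and
    [d], and [P, Q < R] between [a] and [y]. Every 2-colouring of these 13 elements has a
    monochromatic diamond. If the coordinates of a random copy are drawn independently
    from a distribution on the up-sets whose marginal on each nonempty set [A] of
    elements has entropy larger than [c |A|], then the second moment method, restricted
    to the typical words, produces a copy in [P(n, e^(-c n))]. *)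

(** * Lower bounds for the exponential by exact integer arithmetic *)

(** Certificates are evaluated on binary integers, which [vm_compute] handles quickly; [ZtoR]
    carries them to the reals. *)
Definition ZtoR (R : realType) (z : Z) : R := (int_of_Z z)%:~R.

Lemma ZtoRD (R : realType) (x y : Z) :
  ZtoR R (Z.add x y) = ZtoR R x + ZtoR R y.
Proof. by rewrite /ZtoR -intrD; congr _%:~R; exact: (raddfD int_of_Z). Qed.

Lemma ZtoRM (R : realType) (x y : Z) :
  ZtoR R (Z.mul x y) = ZtoR R x * ZtoR R y.
Proof. by rewrite /ZtoR -intrM; congr _%:~R; exact: (rmorphM int_of_Z). Qed.

Lemma ZtoR_le (R : realType) (x y : Z) :
  (ZtoR R x <= ZtoR R y) = Z.leb x y.
Proof. by rewrite /ZtoR ler_int; lia. Qed.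

Lemma ZtoR_lt (R : realType) (x y : Z) :
  (ZtoR R x < ZtoR R y) = Z.ltb x y.
Proof. by rewrite /ZtoR ltr_int; lia. Qed.

Lemma ZtoR_nat (R : realType) (n : nat) : ZtoR R (Z.of_nat n) = n%:R.
Proof. by rewrite /ZtoR -[RHS]/(n%:~R); congr _%:~R; lia. Qed.

Lemma ZtoR_pow2 (R : realType) (n : nat) :
  ZtoR R (Z.pow 2 (Z.of_nat n)) = 2 ^+ n.
Proof.
elim: n => [|n IHn] //.
rewrite Nat2Z.inj_succ Z.pow_succ_r; last exact: Nat2Z.is_nonneg.
by rewrite ZtoRM IHn exprS.
Qed.

Fixpoint fixed_squarings (s : Z) (k : nat) (e : Z) : Z :=
  if k is k'.+1 then fixed_squarings s k' (Z.div (Z.mul e e) s) else e.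

(** Invariant: [e / s] is a nonnegative lower bound of [expR y]. Squaring doubles the exponent, and
    rounding down stays on the safe side. *)
Lemma fixed_squarings_le (R : realType) (s e : Z) (k : nat) (y : R) :
  Z.ltb 0 s -> Z.leb 0 e -> ZtoR R e <= ZtoR R s * expR y ->
  ZtoR R (fixed_squarings s k e) <= ZtoR R s * expR (2 ^+ k * y).
Proof.
move=> s0; elim: k e y => [|k IHk] e y e0 ey; first by rewrite expr0 mul1r.
have sR : 0 < ZtoR R s by rewrite -[0]/(ZtoR R 0) ZtoR_lt.
rewrite exprSr -mulrA /=; apply: IHk.
  by apply/Z.leb_le/Z.div_pos; lia.
rewrite [2 * y]mulr_natl mulr2n expRD -(ler_pM2l sR).
have le1 : ZtoR R s * ZtoR R (Z.div (Z.mul e e) s) <= ZtoR R e * ZtoR R e.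
  by rewrite -!ZtoRM ZtoR_le; apply/Z.leb_le/Z.mul_div_le; lia.
apply: (le_trans le1).
have -> : ZtoR R s * (ZtoR R s * (expR y * expR y)) =
  (ZtoR R s * expR y) * (ZtoR R s * expR y) by ring.
have eR : 0 <= ZtoR R e by rewrite -[0]/(ZtoR R 0) ZtoR_le.
by apply: ler_pM.
Qed.

(* Certifies c / d <= exp (a / b): starting from
   1 + a / (b * 2 ^ k) <= exp (a / (b * 2 ^ k)), square k times in fixed point with scale
   s, rounding downwards. *)
Definition exp_lower_check (s : Z) (k : nat) (a b c d : Z) : bool :=
  let e := Z.add s (Z.div (Z.mul a s) (Z.mul b (Z.pow 2 (Z.of_nat k)))) in
  [&& Z.ltb 0 s, Z.ltb 0 b, Z.ltb 0 d, Z.leb 0 e &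
      Z.leb (Z.mul c s) (Z.mul d (fixed_squarings s k e))].

Lemma exp_lower_checkP (R : realType) (s : Z) (k : nat) (a b c d : Z) :
  exp_lower_check s k a b c d ->
  ZtoR R c / ZtoR R d <= expR (ZtoR R a / ZtoR R b).
Proof.
case/and5P => s0 b0 d0; set e := Z.add _ _ => e0 ce.
have sR : 0 < ZtoR R s by rewrite -[0]/(ZtoR R 0) ZtoR_lt.
have bR : 0 < ZtoR R b by rewrite -[0]/(ZtoR R 0) ZtoR_lt.
have dR : 0 < ZtoR R d by rewrite -[0]/(ZtoR R 0) ZtoR_lt.
have kR : 0 < 2 ^+ k :> R by rewrite exprn_gt0.
have bk0 : Z.ltb 0 (Z.mul b (Z.pow 2 (Z.of_nat k))).
  by rewrite -(ZtoR_lt R) ZtoRM ZtoR_pow2 mulr_gt0.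
have ee : ZtoR R e <= ZtoR R s * expR (ZtoR R a / ZtoR R b / 2 ^+ k).
  apply: (@le_trans _ _ (ZtoR R s * (1 + ZtoR R a / ZtoR R b / 2 ^+ k))).
    rewrite mulrDr mulr1 /e ZtoRD lerD2l -(ler_pM2l (mulr_gt0 bR kR)).
    rewrite -{1}ZtoR_pow2 -!ZtoRM.
    have -> : ZtoR R b * 2 ^+ k * (ZtoR R s * (ZtoR R a / ZtoR R b / 2 ^+ k)) =
              ZtoR R (Z.mul a s).
      by rewrite ZtoRM; field; rewrite !gt_eqF.
    by rewrite ZtoR_le; apply/Z.leb_le/Z.mul_div_le; lia.
  by rewrite ler_pM2l // expR_ge1Dx.
have := @fixed_squarings_le R s e k _ s0 e0 ee.
rewrite mulrCA divff ?gt_eqF // mulr1 => le2.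
rewrite ler_pdivrMr // mulrC -(ler_pM2l sR) mulrCA.
apply: le_trans (ler_wpM2l (ltW dR) le2).
by rewrite -!ZtoRM ZtoR_le Z.mul_comm.
Qed.

Lemma exp_lower_check_ge (R : realType) (s : Z) (k : nat) (a b c d : Z) (x y : R) :
  exp_lower_check s k a b c d ->
  x * ZtoR R b = ZtoR R a -> y * ZtoR R d = ZtoR R c ->
  y <= expR x.
Proof.
move=> chk xb yd; have := @exp_lower_checkP R _ _ _ _ _ _ chk; rewrite -xb -yd.
case/and5P: chk => _ b0 d0 _ _.
by rewrite !mulfK // gt_eqF // -[0]/(ZtoR R 0) ZtoR_lt.
Qed.

(** The checker certifies only lower bounds; applied at [- x] it yields upper bounds through this
    inversion. *)
Lemma expR_le_inv (R : realType) (x z : R) :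
  0 < z -> z^-1 <= expR (- x) -> expR x <= z.
Proof. by move=> z0; rewrite expRN lef_pV2 ?posrE ?expR_gt0. Qed.

(** Each squaring doubles the relative error, so 60 squarings at scale [2 ^ 120] leave an error of
    order [2 ^ -60]. *)
Lemma ln2_checked : exp_lower_check (Z.pow 2 120) 60 69314718056 100000000000 2 1.
Proof. by vm_compute. Qed.

Lemma exp_upper_checked : exp_lower_check (Z.pow 2 120) 60
    (Z.mul (-3 * 69314718056) 97294) 10000000000000000
    10000000000 75622733575.
Proof. by vm_compute. Qed.

Lemma exp_threshold_checked : exp_lower_check (Z.pow 2 120) 60
    (Z.mul 3289037391 686470) 1000000000000000
    95622733580 10000000000.
Proof. by vm_compute. Qed.

(** At the threshold, the factor [p^(2 + 5 th) (2 + 8^th)] of one coordinate is already below 1. A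
    rational [l] slightly above [ln 2] makes [expR (3 * l * th)] an upper bound of [8^th]. *)
Lemma witness_exponent (R : realType) :
  exists th l : R, [/\ 0 <= th, th <= 1, 0 <= l, 2 <= expR l &
    2 + expR (3 * l * th) <
    expR (decimal R [:: 3; 2; 8; 9; 0; 3; 7; 3; 9; 1]%N * (2 + 5 * th))].
Proof.
(* [97294 / 100000] approximates the minimizer of [ln (2 + 8 `^ th) / (2 + 5 * th)],
   whose minimum is below the constant by only 2.7e-11. *)
exists (97294%:R / 100000%:R), (69314718056%:R / 100000000000%:R).
split; [lra | lra | lra | |].
  by apply: (@exp_lower_check_ge R _ _ _ _ _ _ _ _ ln2_checked); rewrite /ZtoR; field.
have z0 : 0 < 75622733575%:R / 10000000000%:R :> R by lra.
apply: (@lt_le_trans _ _ (95622733580%:R / 10000000000%:R)).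
  apply: (@le_lt_trans _ _ (2 + 75622733575%:R / 10000000000%:R)); last by lra.
  rewrite lerD2l; apply: (@expR_le_inv R _ _ z0).
  apply: (@exp_lower_check_ge R _ _ _ _ _ _ _ _ exp_upper_checked).
    by rewrite ZtoRM /ZtoR; field.
  by rewrite /ZtoR; field.
apply: (@exp_lower_check_ge R _ _ _ _ _ _ _ _ exp_threshold_checked).
  by rewrite ZtoRM /ZtoR /decimal /foldr; field.
by rewrite /ZtoR; field.
Qed.

(** * Random subsets *)

Lemma subset_weight_ge0 (R : realType) (T : finType) (p : R) (S : {set T}) :
  0 <= p <= 1 -> 0 <= \prod_(x : T) (if x \in S then p else 1 - p).
Proof.
by case/andP=> p0 p1; apply: prodr_ge0 => x _; case: ifP => // _; rewrite subr_ge0.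
Qed.

Lemma random_subset_prob_ge0 (R : realType) (T : finType) (p : R)
    (E : {set T} -> Prop) : 0 <= p <= 1 -> 0 <= random_subset_prob p E.
Proof. by move=> p01; apply: sumr_ge0 => S _; exact: subset_weight_ge0. Qed.

Lemma random_subset_prob_le (R : realType) (T : finType) (p : R)
    (E F : {set T} -> Prop) : 0 <= p <= 1 -> (forall S, E S -> F S) ->
  random_subset_prob p E <= random_subset_prob p F.
Proof.
move=> p01 EF; rewrite /random_subset_prob [leLHS]big_mkcond [leRHS]big_mkcond.
apply: ler_sum => S _; have w0 := @subset_weight_ge0 R T p S p01.
case: asboolP => [/EF FS|_]; first by rewrite asboolT.
by case: ifP.
Qed.

Lemma random_subset_prob_not (R : realType) (T : finType) (p : R)
    (E : {set T} -> Prop) :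
  random_subset_prob p (fun S => ~ E S) = 1 - random_subset_prob p E.
Proof.
apply/eqP; rewrite eq_sym subr_eq; apply/eqP.
rewrite -(@random_subset_prob_total R T p) /random_subset_prob.
rewrite [LHS](bigID (fun S => `[< E S >])) /= addrC.
congr (_ + _); apply: eq_bigl => S; rewrite (asboolT I) //=.
by rewrite asbool_neg.
Qed.

Lemma random_subset_prob_union (R : realType) (T I : finType) (p : R)
    (Q : pred I) (E : I -> {set T} -> Prop) : 0 <= p <= 1 ->
  random_subset_prob p (fun S => exists2 i, Q i & E i S) <=
  \sum_(i | Q i) random_subset_prob p (E i).
Proof.
move=> p01; rewrite /random_subset_prob.
under [leRHS]eq_bigr do rewrite big_mkcond.
rewrite exchange_big /= big_mkcond; apply: ler_sum => S _.
have w0 := @subset_weight_ge0 R T p S p01.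
case: asboolP => [[i Qi ES]|_]; last by apply: sumr_ge0 => i _; case: ifP.
rewrite (bigD1 i) //= asboolT // lerDl.
by apply: sumr_ge0 => j _; case: ifP.
Qed.

(** Members of the interval all contain [x], so [u :\: x] determines [u]. *)
Lemma card_interval (n : nat) (x y : {set 'I_n}) :
  (#|[set u : {set 'I_n} | (x \subset u) && (u \subset y)]| <= 2 ^ #|y :\: x|)%N.
Proof.
rewrite -card_powerset.
have -> : #|[set u : {set 'I_n} | (x \subset u) && (u \subset y)]| =
  #|[set u :\: x | u in [set u : {set 'I_n} | (x \subset u) && (u \subset y)]]|.
  rewrite card_in_imset // => u v; rewrite !inE => /andP[xu _] /andP[xv _] uv.
  by rewrite -(finset.setID u x) -(finset.setID v x) uv !(finset.setIidPr _).
apply/subset_leq_card/fintype.subsetP => w /imsetP[u]; rewrite !inE => /andP[_ uy] ->.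
by rewrite finset.setSD.
Qed.

(** Coordinates are independent: each lies in both sets or in neither, with factor 1, or in the
    upper set only, with factor [r]. *)
Lemma sum_chains (R : realType) (n : nat) (r : R) :
  \sum_(xy : {set 'I_n} * {set 'I_n} | xy.1 \subset xy.2) r ^+ #|xy.2 :\: xy.1|
  = (2 + r) ^+ n.
Proof.
(* Factor of a coordinate with membership [a] in [x] and [b] in [y]; the value 0 of [f true false]
   discards pairs that are not nested. *)
pose f (a b : bool) : R := if a then b%:R else if b then r else 1.
rewrite -[n in RHS]card_ord -prodr_const.
have -> : 2 + r = 1 + (1 + r) by ring.
rewrite bigA_distr /= big_mkcond /=.
rewrite -(pair_big xpredT xpredT (fun x y : {set 'I_n} =>
  if x \subset y then r ^+ #|y :\: x| else 0)) /=.
apply: eq_bigr => x _.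
transitivity (\prod_(i < n) (f (i \in x) true + f (i \in x) false)); last first.
  by apply: eq_bigr => i _; rewrite /f; case: ifP => _ /=; ring.
rewrite bigA_distr; apply: eq_bigr => y _.
case: ifPn => [xy|].
  rewrite -prodr_const [RHS](bigID (mem (y :\: x))) /= [X in _ * X]big1 ?mulr1.
    by apply: eq_bigr => i; rewrite inE => /andP[ix iy]; rewrite iy /f (negbTE ix).
  move=> i; rewrite inE negb_and negbK /f => /orP[ix|iy].
    by rewrite ix (fintype.subsetP xy).
  rewrite (negbTE iy); case: ifP => // ix.
  by rewrite (fintype.subsetP xy) // in iy.
case/fintype.subsetPn => i ix iy.
by rewrite (bigD1 i) //= (negbTE iy) /f ix mul0r.
Qed.

(** * Two stacked diamonds *)

Lemma diamond_copy d (P : porderType d) (phi : {set 'I_2} -> P) :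
  is_copy phi ->
  [/\ (phi finset.set0 < phi [set ord0])%O, (phi finset.set0 < phi [set ord_max])%O,
      (phi [set ord0] < phi finset.setT)%O, (phi [set ord_max] < phi finset.setT)%O &
      phi [set ord0] != phi [set ord_max]].
Proof.
case=> phi_inj phi_homo.
have lt (A B : {set 'I_2}) : A \subset B -> ~~ (B \subset A) -> (phi A < phi B)%O.
  move=> AB BA; rewrite lt_neqAle (inj_eq phi_inj) phi_homo // andbT.
  by apply: contraNneq BA => ->.
split; first [apply: lt | rewrite (inj_eq phi_inj)].
- exact: finset.sub0set.
- by apply/fintype.subsetPn; exists ord0; rewrite inE.
- exact: finset.sub0set.
- by apply/fintype.subsetPn; exists ord_max; rewrite inE.
- exact: finset.subsetT.
- by apply/fintype.subsetPn; exists ord_max; rewrite inE.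
- exact: finset.subsetT.
- by apply/fintype.subsetPn; exists ord0; rewrite inE.
- by apply/eqP => /finset.setP/(_ ord0); rewrite !inE.
Qed.

Lemma uniq_two_diamonds d (P : porderType d) (x a b u v w y : P) :
  (x < a)%O -> (x < b)%O -> (a < u)%O -> (b < u)%O -> a != b ->
  (u < v)%O -> (u < w)%O -> (v < y)%O -> (w < y)%O -> v != w ->
  uniq [:: x; a; b; u; v; w; y].
Proof.
move=> xa xb au bu ab uv uw vy wy vw; rewrite /= !inE !negb_or !andbT.
have xu := lt_trans xa au; have uy := lt_trans uv vy.
rewrite ab vw (lt_eqF xa) (lt_eqF xb) (lt_eqF au) (lt_eqF bu) (lt_eqF uv) (lt_eqF uw).
rewrite (lt_eqF vy) (lt_eqF wy) (lt_eqF xu) (lt_eqF uy) (lt_eqF (lt_trans au uv)).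
rewrite (lt_eqF (lt_trans au uw)) (lt_eqF (lt_trans bu uv)) (lt_eqF (lt_trans bu uw)).
rewrite (lt_eqF (lt_trans xu uv)) (lt_eqF (lt_trans xu uw)) (lt_eqF (lt_trans xu uy)).
by rewrite (lt_eqF (lt_trans au uy)) (lt_eqF (lt_trans bu uy)).
Qed.

Lemma le_val_subset (n : nat) (S : {set {set 'I_n}}) (A B : subposet S) :
  (A <= B)%O -> val A \subset val B.
Proof. by []. Qed.

Definition two_diamonds (n : nat) (x y : {set 'I_n}) (S : {set {set 'I_n}}) : Prop :=
  exists a b u d e : {set 'I_n},
    [/\ [/\ x \subset a, x \subset b, a \subset u & b \subset u],
        [/\ u \subset d, u \subset e, d \subset y & e \subset y],
        uniq [:: x; a; b; u; d; e; y] &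
        {subset [:: x; a; b; u; d; e; y] <= S}].

(* Colouring the tops of diamonds against all other elements, a monochromatic
   diamond must start at the top of another one. *)
Lemma ramsey_two_diamonds (n : nat) (S : {set {set 'I_n}}) :
  ramsey {set 'I_2} (subposet S) 2 -> exists x y, two_diamonds x y S.
Proof.
pose top (z : subposet S) :=
  exists2 phi : {set 'I_2} -> subposet S, is_copy phi & phi finset.setT = z.
move/(_ (fun z => if `[< top z >] then ord_max else ord0)) => [phi phiC [i phi_i]].
(* The top of the monochromatic diamond has the colour of tops, hence so does its bottom. *)
have : top (phi finset.set0).
  move: (phi_i finset.setT) (phi_i finset.set0); rewrite asboolT; last by exists phi.
  by move=> <-; case: asboolP.
case=> psi psiC psi_top.
case: (diamond_copy phiC) (diamond_copy psiC) => ud ue dy ey de.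
rewrite psi_top => -[xa xb au bu ab].
exists (val (psi finset.set0)), (val (phi finset.setT)).
exists (val (psi [set ord0])), (val (psi [set ord_max])), (val (phi finset.set0)),
  (val (phi [set ord0])), (val (phi [set ord_max])).
split.
- by split; apply: le_val_subset; apply: ltW.
- by split; apply: le_val_subset; apply: ltW.
- rewrite -[X in uniq X]/(map val [:: psi finset.set0; psi [set ord0]; psi [set ord_max];
    phi finset.set0; phi [set ord0]; phi [set ord_max]; phi finset.setT]).
  rewrite (@map_inj_uniq _ _ (val : subposet S -> {set 'I_n}) val_inj).
  exact: uniq_two_diamonds.
- by move=> z; rewrite !inE => /or4P[|||/or4P[]] /eqP ->; exact: valP.
Qed.

(** Distinctness is part of the event, so that a list with repetitions gives probability 0 and needs
    no separate treatment in union bounds. *)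
Lemma random_subset_prob_seq (R : realType) (T : finType) (p : R) (s : seq T) :
  0 <= p <= 1 ->
  random_subset_prob p (fun S => uniq s /\ {subset s <= S}) <= p ^+ size s.
Proof.
move=> p01; have [us|us] := boolP (uniq s); last first.
  rewrite /random_subset_prob big1 => [|S]; last by rewrite asboolF // => -[].
  by apply: exprn_ge0; case/andP: p01.
have -> : size s = #|[set x in s]| by rewrite cardsE (card_uniqP us).
rewrite -random_subset_prob_sup; apply: random_subset_prob_le => // S [_ sS].
by apply/fintype.subsetP => x; rewrite inE => /sS.
Qed.

Lemma two_diamonds_prob_endpoints (R : realType) (n : nat) (p : R) (x y : {set 'I_n}) :
  0 <= p <= 1 -> random_subset_prob p (two_diamonds x y) <= p ^+ 2.
Proof.
move=> p01; apply: le_trans (random_subset_prob_seq [:: x; y] p01).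
apply: random_subset_prob_le => // S [a [b [u [d [e [_ _ us sS]]]]]].
split; last by move=> z; rewrite !inE => /orP[]/eqP ->; apply: sS; rewrite !inE eqxx ?orbT.
case/andP: us => xs _; rewrite /= !andbT; apply: contra xs; rewrite inE => /eqP ->.
by rewrite !inE eqxx !orbT.
Qed.

(** The five inner sets are coded by three sets between [x] and [y]: [u], one for the pair [a], [d]
    and one for the pair [b], [e]. Each has at most [2^g] values, where [g] is the size of
    [y :\: x]. *)
Lemma two_diamonds_prob_all (R : realType) (n : nat) (p : R) (x y : {set 'I_n}) :
  0 <= p <= 1 -> random_subset_prob p (two_diamonds x y) <= 8 ^+ #|y :\: x| * p ^+ 7.
Proof.
move=> p01; pose J := [set u : {set 'I_n} | (x \subset u) && (u \subset y)].
pose s (w : {set 'I_n} * ({set 'I_n} * {set 'I_n})) :=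
  [:: x; w.1 :&: w.2.1; w.1 :&: w.2.2; w.1; w.1 :|: w.2.1; w.1 :|: w.2.2; y].
pose Q := [set w | (w.1 \in J) && ((w.2.1 \in J) && (w.2.2 \in J))].
apply: (@le_trans _ _ (\sum_(w in Q) p ^+ 7)); last first.
  rewrite sumr_const -[X in X <= _]mulr_natl ler_wpM2r ?exprn_ge0 //; first by case/andP: p01.
  have -> : Q = finset.setX J (finset.setX J J).
    by apply/finset.setP => -[u [a b]]; rewrite !inE.
  rewrite !finset.cardsX -(natrX _ 8) ler_nat (_ : 8 = 2 * (2 * 2))%N // !expnMn.
  by rewrite -?mulnA !leq_mul // card_interval.
apply: (@le_trans _ _ (random_subset_prob p
  (fun S => exists2 w, w \in Q & uniq (s w) /\ {subset s w <= S}))).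
  apply: random_subset_prob_le => // S [a [b [u [d [e [[xa xb au bu] [ud ue dy ey] us sS]]]]]].
  (* Sets [a, u, d] with [a <= u <= d] are [u :&: s, u, u :|: s] for a set [s]. *)
  exists (u, (a :|: (d :\: u), b :|: (e :\: u))).
    rewrite !inE /= (fintype.subset_trans xa au) (fintype.subset_trans ud dy) /=.
    rewrite !finset.subUset (fintype.subset_trans au (fintype.subset_trans ud dy)).
    rewrite (fintype.subset_trans bu (fintype.subset_trans ud dy)).
    rewrite (fintype.subset_trans xa (finset.subsetUl _ _)).
    rewrite (fintype.subset_trans xb (finset.subsetUl _ _)) /=.
    by rewrite !(fintype.subset_trans (finset.subsetDl _ _)).
  have I (A B : {set 'I_n}) : A \subset u -> u :&: (A :|: (B :\: u)) = A.
    move=> Au; rewrite finset.setIUr finset.setIDA (finset.setIC u B) -finset.setIDA.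
    by rewrite finset.setDv finset.setI0 finset.setU0; apply/finset.setIidPr.
  have U (A B : {set 'I_n}) : A \subset u -> u \subset B -> u :|: (A :|: (B :\: u)) = B.
    move=> Au uB; rewrite finset.setUA (finset.setUidPl Au); apply/finset.setP => z.
    by rewrite !inE; case zu: (z \in u); rewrite //= (fintype.subsetP uB).
  by rewrite /s /= !I // !U.
apply: (le_trans (random_subset_prob_union _ _ p01)).
by apply: ler_sum => w _; exact: (random_subset_prob_seq (s w) p01).
Qed.

(** Interpolation: the minimum of [p^2] and [8^g p^7] is at most their weighted geometric mean
    [p^(2 + 5 th) 8^(th g)], which [sum_chains] sums over all nested pairs. *)
Lemma ramsey_prob_le (R : realType) (n : nat) (w th l : R) :
  0 <= w -> 0 <= th <= 1 -> 2 <= expR l ->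
  random_subset_prob (expR (- w)) (fun S => ramsey {set 'I_2} (@subposet _ {set 'I_n} S) 2) <=
  expR (- ((2 + 5 * th) * w)) * (2 + expR (3 * l * th)) ^+ n.
Proof.
move=> w0 /andP[th0 th1] l2; set p := expR (- w).
have p01 : 0 <= p <= 1.
  by rewrite expR_ge0 /= -[leRHS]expR0 ler_expR oppr_le0.
pose E (xy : {set 'I_n} * {set 'I_n}) := two_diamonds xy.1 xy.2.
apply: (@le_trans _ _ (random_subset_prob p
  (fun S => exists2 xy : {set 'I_n} * {set 'I_n}, xy.1 \subset xy.2 & E xy S))).
  apply: random_subset_prob_le => // S /ramsey_two_diamonds.
  move=> [x [y xy]]; exists (x, y) => //=.
  case: xy => a [b [u [d [e [[xa _ au _] [ud _ dy _] _ _]]]]].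
  exact: (fintype.subset_trans xa (fintype.subset_trans au (fintype.subset_trans ud dy))).
apply: (le_trans (random_subset_prob_union _ _ p01)).
rewrite -sum_chains mulr_sumr; apply: ler_sum => -[x y] /= _.
rewrite /E /=; set g := #|y :\: x|.
have ek (k : nat) : p ^+ k = expR (- (k%:R * w)) by rewrite -mulrN expRM_natl.
have -> : expR (- ((2 + 5 * th) * w)) * expR (3 * l * th) ^+ g =
  expR (th * (3 * l * g%:R - 5 * w) - 2 * w).
  by rewrite -expRM_natl -expRD; congr expR; ring.
(* The sign tells which bound is smaller: [p^2] if nonnegative, the expected number of
   configurations otherwise. *)
have [le0|lt0] := leP 0 (3 * l * g%:R - 5 * w).
  apply: le_trans (two_diamonds_prob_endpoints x y p01) _.
  by rewrite ek ler_expR addrC lerDl mulr_ge0.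
apply: le_trans (two_diamonds_prob_all x y p01) _.
apply: (@le_trans _ _ (expR (3 * l * g%:R) * expR (- (7 * w)))).
  rewrite ek ler_pM2r ?expR_gt0 // mulrC expRM_natl lerXn2r ?nnegrE ?expR_ge0 //.
  rewrite expRM_natl (_ : 8 = 2 ^+ 3) ?lerXn2r ?nnegrE ?expR_ge0 //.
  by rewrite -natrX.
rewrite -expRD ler_expR; set z := _ - _ in lt0 *.
have -> : 3 * l * g%:R + - (7 * w) = z - 2 * w by rewrite /z; ring.
by rewrite lerD2r; nra.
Qed.

Lemma not_ramsey_whp (R : realType) (c : R) :
  decimal R [:: 3; 2; 8; 9; 0; 3; 7; 3; 9; 1]%N < c ->
  whp (fun n : nat => expR (- c * n%:R))
       (fun n S => ~ ramsey {set 'I_2} (subposet S) 2).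
Proof.
move=> c0; have [th [l [th0 th1 l0 l2 lt]]] := witness_exponent R.
have d0 : 0 <= decimal R [:: 3; 2; 8; 9; 0; 3; 7; 3; 9; 1]%N.
  by rewrite /decimal /foldr; lra.
have cp : 0 <= c := le_trans d0 (ltW c0).
(* The probability of being Ramsey is at most [rho ^+ n]. *)
pose rho := (2 + expR (3 * l * th)) * expR (- (c * (2 + 5 * th))).
have z0 : 0 < 2 + expR (3 * l * th) by rewrite addr_gt0 ?expR_gt0.
have rho0 : 0 <= rho by rewrite mulr_ge0 ?expR_ge0 // ltW.
have rho1 : `|rho| < 1.
  rewrite ger0_norm // /rho expRN ltr_pdivrMr ?expR_gt0 // mul1r.
  by apply: (lt_le_trans lt); rewrite ler_expR ler_wpM2r ?ltW //; lra.
rewrite /whp -[X in (_ --> X)%classic]subr0.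
rewrite (_ : (fun n => _) = (fun n => 1 - random_subset_prob (expR (- c * n%:R))
  (fun S => ramsey {set 'I_2} (@subposet _ {set 'I_n} S) 2))); last first.
  by apply/funext => n; exact: random_subset_prob_not.
apply: cvgB; first exact: cvg_cst.
apply: (@squeeze_cvgr _ _ _ _ (fun=> 0) (fun n => rho ^+ n)); last 2 first.
- exact: cvg_cst.
- exact: cvg_expr.
near=> n.
have w0 : 0 <= c * n%:R by rewrite mulr_ge0.
rewrite mulNr random_subset_prob_ge0 /=; last first.
  by rewrite expR_ge0 /= -[leRHS]expR0 ler_expR oppr_le0.
have th01 : 0 <= th <= 1 by rewrite th0.
apply: le_trans (ramsey_prob_le n w0 th01 l2) _.
rewrite /rho exprMn [leLHS]mulrC ler_pM2l ?exprn_gt0 // -expRM_natl ler_expR.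
by rewrite le_eqVlt; apply/orP; left; apply/eqP; ring.
Unshelve. all: by end_near.
Qed.

(** * The second moment method for copies given by random words *)

(** Chebyshev's inequality for the number [X] of indices [i] in [G] with [B i] inside the random
    set: where [X = 0], the squared deviation is the squared mean. *)
Lemma random_subset_second_moment (R : realType) (T I : finType) (p : R)
    (G : {set I}) (B : I -> {set T}) : 0 <= p <= 1 ->
  random_subset_prob p (fun S => forall i, i \in G -> ~~ (B i \subset S)) *
    (\sum_(i in G) p ^+ #|B i|) ^+ 2 <=
  \sum_(i in G) \sum_(j in G) p ^+ #|B i :|: B j| - (\sum_(i in G) p ^+ #|B i|) ^+ 2.
Proof.
move=> p01; set m := \sum_(i in G) p ^+ #|B i|.
pose wt (S : {set T}) : R := \prod_(x : T) (if x \in S then p else 1 - p).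
pose X (S : {set T}) : R := \sum_(i in G) (B i \subset S)%:R.
have supE (A : {set T}) : \sum_S wt S * (A \subset S)%:R = p ^+ #|A|.
  rewrite -random_subset_prob_sup /random_subset_prob [RHS]big_mkcond.
  by apply: eq_bigr => S _; rewrite asboolb; case: ifP => _; rewrite ?mulr1 ?mulr0.
have w1 : \sum_S wt S = 1.
  rewrite -(expr0 p) -(@cards0 T) -supE; apply: eq_bigr => S _.
  by rewrite finset.sub0set mulr1.
have EX : \sum_S wt S * X S = m.
  under eq_bigr do rewrite /X mulr_sumr.
  by rewrite exchange_big /=; apply: eq_bigr => i _; exact: supE.
have EX2 : \sum_S wt S * X S ^+ 2 = \sum_(i in G) \sum_(j in G) p ^+ #|B i :|: B j|.
  transitivity (\sum_S \sum_(i in G) \sum_(j in G) wt S * (B i :|: B j \subset S)%:R).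
    apply: eq_bigr => S _; rewrite expr2 {1}/X mulr_suml mulr_sumr.
    apply: eq_bigr => i _; rewrite /X !mulr_sumr; apply: eq_bigr => j _.
    by rewrite finset.subUset -natrM mulnb.
  rewrite exchange_big /=; apply: eq_bigr => i _.
  by rewrite exchange_big /=; apply: eq_bigr => j _; exact: supE.
apply: (@le_trans _ _ (\sum_S wt S * (X S - m) ^+ 2)).
  rewrite /random_subset_prob mulr_suml big_mkcond; apply: ler_sum => S _.
  have wS : 0 <= wt S by exact: subset_weight_ge0.
  case: asboolP => [H|_]; last by rewrite mulr_ge0 ?sqr_ge0.
  have -> : X S = 0 by apply: big1 => i /H /negbTE ->.
  by rewrite sub0r sqrrN.
rewrite le_eqVlt; apply/orP; left; apply/eqP.
under eq_bigr do rewrite sqrrB mulrDr mulrBr.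
rewrite big_split sumrB /= EX2 -mulr_suml w1 mul1r.
have -> : \sum_S wt S * (X S * m *+ 2) = m * m *+ 2.
  rewrite -mulrnAr -{2}EX mulr_suml.
  by apply: eq_bigr => S _; ring.
ring.
Qed.

(* A word [w] over [D] encodes a map [V -> P(n)]: the letter [w i] tells which of the
   images contain [i]. *)
Definition type_map (V D : finType) (typ : V -> D -> bool) (n : nat)
    (w : {ffun 'I_n -> D}) (v : V) : {set 'I_n} := [set i | typ v (w i)].

(* [fiber_size typ A j / #|D|] is the probability of the restriction of the letter [j]
   to [A] when letters are drawn uniformly. *)
Definition fiber_size (V D : finType) (typ : V -> D -> bool) (A : {set V}) (j : D) : nat :=
  #|[set k | [forall v in A, typ v k == typ v j]]|.

(** Agreement on [A] is a separate condition on each letter, so the words form a product set. *)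
Lemma card_type_map_fiber (V D : finType) (typ : V -> D -> bool) (n : nat)
    (A : {set V}) (w0 : {ffun 'I_n -> D}) :
  #|[set w : {ffun 'I_n -> D} | [forall v in A, type_map typ w v == type_map typ w0 v]]|
  = (\prod_(i < n) fiber_size typ A (w0 i))%N.
Proof.
pose F (i : 'I_n) : {set D} := [set k | [forall v in A, typ v k == typ v (w0 i)]].
transitivity #|family F|; last by rewrite card_family foldrE big_image.
apply: eq_card => w; rewrite inE; apply/forall_inP/familyP => [H i|H v vA].
  rewrite inE; apply/forall_inP => v vA.
  by have /eqP/finset.setP/(_ i) := H v vA; rewrite !inE => ->.
apply/eqP/finset.setP => i; rewrite !inE.
by have := H i; rewrite inE => /forall_inP/(_ v vA)/eqP.
Qed.

(** The sum of exponentials equals [#|D|] at [s = 0] and has negative derivative there. *)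
Lemma chernoff_exponent (R : realType) (D : finType) (a : D -> R) :
  \sum_j a j < 0 -> exists2 s : R, 0 < s & \sum_j expR (s * a j) < #|D|%:R.
Proof.
move=> a0; pose q := \sum_j a j ^+ 2; pose B := 1 + q; pose t := - \sum_j a j.
have t0 : 0 < t by rewrite oppr_gt0.
have q0 : 0 <= q by apply: sumr_ge0 => j _; exact: sqr_ge0.
have B0 : 0 < B by rewrite /B; lra.
have aB j : `|a j| <= B.
  have : a j ^+ 2 <= q.
    by rewrite /q (bigD1 j) //= lerDl; apply: sumr_ge0 => i _; exact: sqr_ge0.
  by rewrite -real_normK ?num_real // /B; set x := `|a j|; nra.
(* The first bound keeps [s * a j] within [1 / 2], where a quadratic estimate of [expR] holds; the
   second makes the quadratic term at most half of the linear gain [s * t]. *)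
pose s := Num.min (1 / (2 * B)) (t / (4 * B)).
have s0 : 0 < s by rewrite lt_min !divr_gt0 ?mulr_gt0.
have s1 : s * B <= 1 / 2.
  apply: (@le_trans _ _ (1 / (2 * B) * B)); first by rewrite ler_pM2r // ge_min lexx.
  by rewrite le_eqVlt; apply/orP; left; apply/eqP; field; rewrite gt_eqF.
have s2 : s * (4 * B) <= t by rewrite -ler_pdivlMr ?mulr_gt0 // ge_min lexx orbT.
exists s => //.
have e_le (z : R) : `|z| <= 1 / 2 -> expR z <= 1 + z + 2 * z ^+ 2.
  rewrite ler_norml => /andP[z1 z2].
  have zz : 0 < 1 - z by lra.
  have : (1 - z) * expR z <= 1.
    rewrite -[X in _ * X]invrK -expRN ler_pdivrMr ?expR_gt0 // mul1r.
    exact: expR_ge1Dx.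
  have e0 := expR_gt0 z; move=> h.
  rewrite -(ler_pM2l zz); apply: (le_trans h).
  (* This product equals [(1 - z) * (1 + z + 2 * z ^+ 2) - 1]. *)
  have : 0 <= z ^+ 2 * (1 - 2 * z) by rewrite mulr_ge0 ?sqr_ge0 //; lra.
  by move=> ?; nra.
apply: (@le_lt_trans _ _ (\sum_j (1 + s * a j + 2 * (s * a j) ^+ 2))).
  apply: ler_sum => j _; apply: e_le; rewrite normrM gtr0_norm //.
  by apply: le_trans s1; rewrite ler_pM2l.
rewrite !big_split /= sumr_const -mulr_sumr -[X in _ < X]addr0 -addrA ltrD2l.
have -> : \sum_j 2 * (s * a j) ^+ 2 = 2 * s ^+ 2 * q.
  by rewrite mulr_sumr; apply: eq_bigr => j _; ring.
rewrite -[\sum_j a j]opprK -/t.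
have sq : s * q <= s * B by rewrite ler_pM2l // /B lerDr.
by nra.
Qed.

(** Exponential Markov inequality: each counted word contributes at least 1 to the expanded
    power. *)
Lemma card_positive_sum (R : realType) (D : finType) (n : nat) (a : D -> R) (s : R) :
  0 < s ->
  #|[set w : {ffun 'I_n -> D} | 0 < \sum_(i < n) a (w i)]|%:R <=
  (\sum_j expR (s * a j)) ^+ n.
Proof.
move=> s0; rewrite -[n in X in _ <= X]card_ord -prodr_const bigA_distr_bigA /=.
rewrite -sum1_card natr_sum big_mkcond; apply: ler_sum => w _.
rewrite -expR_sum -mulr_sumr; case: ifP => [|_]; last exact: expR_ge0.
rewrite inE => h; rewrite -[leLHS]expR0 ler_expR mulr_ge0 // ltW //.
Qed.

(** Let [A] collect the elements whose image under [w] is also an image under [w'], matched by a map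
    [s]. The union of the images misses at most [#|A|] of the [2 * #|V|] possible sets, and few [w]
    are compatible with a given nonempty [A] and [s]; summing over all [A] and [s] gives the error
    term. *)
Lemma pairs_sum_le (R : realType) (V D : finType) (typ : V -> D -> bool) (n : nat)
    (p eps : R) (G : {set {ffun 'I_n -> D}}) (w' : {ffun 'I_n -> D}) :
  0 < p <= 1 -> 0 <= eps ->
  (forall w, w \in G -> injective (type_map typ w)) ->
  (forall (A : {set V}) w, A != finset.set0 -> w \in G ->
     (\prod_(i < n) fiber_size typ A (w i))%N%:R <= eps * #|D|%:R ^+ n * p ^+ #|A|) ->
  w' \in G ->
  \sum_(w in G) p ^+ #|[set type_map typ w v | v : V] :|: [set type_map typ w' v | v : V]|
  <= p ^+ (2 * #|V|) * #|D|%:R ^+ n *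
     (1 + #|{: {set V} * {ffun V -> V}}|%:R * eps).
Proof.
case/andP=> p0 p1 eps0 Ginj Geps w'G.
set k := #|V|; set N : R := #|D|%:R ^+ n.
pose im (w : {ffun 'I_n -> D}) := [set type_map typ w v | v : V].
pose agree (A : {set V}) (s : {ffun V -> V}) (w : {ffun 'I_n -> D}) :=
  [forall v in A, type_map typ w v == type_map typ w' (s v)].
pose term (As : {set V} * {ffun V -> V}) (w : {ffun 'I_n -> D}) : R :=
  ((As.1 != finset.set0) && agree As.1 As.2 w)%:R * (p ^+ (2 * k) / p ^+ #|As.1|).
have term0 As w : 0 <= term As w by rewrite mulr_ge0 // divr_ge0 // exprn_ge0 // ltW.
have card_im w : w \in G -> #|im w| = k by move=> wG; rewrite card_imset //; exact: Ginj.
have one w : w \in G -> p ^+ #|im w :|: im w'| <= p ^+ (2 * k) + \sum_As term As w.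
  move=> wG; pose A := [set v | type_map typ w v \in im w'].
  have UI : (#|im w :|: im w'| + #|im w :&: im w'| = 2 * k)%N.
    by rewrite finset.cardsUI !card_im // mul2n addnn.
  have IA : (#|im w :&: im w'| <= #|A|)%N.
    apply: (leq_trans _ (leq_imset_card (type_map typ w) A)).
    apply/subset_leq_card/fintype.subsetP => z; rewrite inE => /andP[/imsetP[v _ ->] vw'].
    by apply/imsetP; exists v; rewrite ?inE.
  have S0 : 0 <= \sum_As term As w by apply: sumr_ge0.
  have [A0|A0] := eqVneq A finset.set0.
    move: IA; rewrite A0 cards0 leqn0 => /eqP I0; move: UI; rewrite I0 addn0 => ->.
    by rewrite lerDl.
  pose s : {ffun V -> V} := [ffun v => odflt v [pick u | type_map typ w v == type_map typ w' u]].
  have As : agree A s w.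
    apply/forall_inP => v; rewrite inE ffunE; case: pickP => //= none /imsetP[u _ e].
    by have := none u; rewrite e eqxx.
  apply: (@le_trans _ _ (term (A, s) w)); last first.
    rewrite (bigD1 (A, s)) //= addrCA lerDl; apply: addr_ge0.
      by rewrite exprn_ge0 ?ltW.
    exact: sumr_ge0.
  rewrite /term /= A0 As mul1r ler_pdivlMr ?exprn_gt0 // -UI exprD.
  by rewrite ler_pM2l ?exprn_gt0 // ler_wiXn2l ?(ltW p0).
apply: (@le_trans _ _ (\sum_(w in G) (p ^+ (2 * k) + \sum_As term As w))).
  exact: ler_sum.
rewrite big_split /= exchange_big /= sumr_const -[_ *+ #|G|]mulr_natr.
have cardN (B : {set {ffun 'I_n -> D}}) : #|B|%:R <= N.
  by rewrite /N -natrX ler_nat (leq_trans (max_card (mem B))) // card_ffun card_ord.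
rewrite mulrDr mulr1; apply: lerD; first by rewrite ler_pM2l ?exprn_gt0.
have -> : p ^+ (2 * k) * N * (#|{: {set V} * {ffun V -> V}}|%:R * eps) =
  \sum_(As : {set V} * {ffun V -> V}) p ^+ (2 * k) * N * eps.
  rewrite sumr_const -[_ *+ _ in RHS]mulr_natr; ring.
apply: ler_sum => -[A s] _; rewrite /term /= -mulr_suml.
have [->|A0] /= := eqVneq A finset.set0.
  by rewrite big1 // mul0r !mulr_ge0 // exprn_ge0 // ltW.
have -> : \sum_(w in G) (agree A s w)%:R = #|[set w in G | agree A s w]|%:R :> R.
  by rewrite -sum1_card natr_sum [RHS]big_mkcond [LHS]big_mkcond; apply: eq_bigr => w _;
    rewrite inE; case: (w \in G); case: (agree A s w).
have h : #|[set w in G | agree A s w]|%:R <= eps * N * p ^+ #|A|.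
  (* All counted words agree on [A] with any one of them, [w0], so the fibre bound at [w0] counts
     them. *)
  have [->|[w0]] := finset.set_0Vmem [set w in G | agree A s w].
    by rewrite cards0 !mulr_ge0 // exprn_ge0 // ltW.
  rewrite inE => /andP[w0G /forall_inP w0s]; apply: le_trans (Geps A w0 A0 w0G).
  rewrite ler_nat -card_type_map_fiber; apply/subset_leq_card/fintype.subsetP => w.
  rewrite !inE => /andP[_ /forall_inP ws]; apply/forall_inP => v vA.
  by rewrite (eqP (ws v vA)) (eqP (w0s v vA)).
have pA : 0 < p ^+ #|A| by rewrite exprn_gt0.
apply: (@le_trans _ _ (eps * N * p ^+ #|A| * (p ^+ (2 * k) / p ^+ #|A|))).
  by rewrite ler_pM2r // divr_gt0 // exprn_gt0.
by rewrite le_eqVlt; apply/orP; left; apply/eqP; field; rewrite gt_eqF.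
Qed.

(** The second moment divided by the squared mean is at most the subtracted quotient; hence no copy
    from [G] appears with probability at most that quotient minus 1. *)
Lemma type_copy_prob_ge (R : realType) (V D : finType) (typ : V -> D -> bool) (n : nat)
    (p eps : R) (G : {set {ffun 'I_n -> D}}) :
  0 < p <= 1 -> 0 <= eps ->
  (forall w, w \in G -> injective (type_map typ w)) ->
  (forall (A : {set V}) w, A != finset.set0 -> w \in G ->
     (\prod_(i < n) fiber_size typ A (w i))%N%:R <= eps * #|D|%:R ^+ n * p ^+ #|A|) ->
  (0 < #|G|)%N ->
  2 - (1 + #|{: {set V} * {ffun V -> V}}|%:R * eps) / (#|G|%:R / #|D|%:R ^+ n) <=
  random_subset_prob p (fun S => exists2 w : {ffun 'I_n -> D},
    injective (type_map typ w) & forall v, type_map typ w v \in S).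
Proof.
move=> p01 eps0 Ginj Geps G0; case/andP: (p01) => p0 p1.
have p01' : 0 <= p <= 1 by rewrite (ltW p0).
set N : R := #|D|%:R ^+ n; set K := 1 + _.
pose im (w : {ffun 'I_n -> D}) := [set type_map typ w v | v : V].
have card_im w : w \in G -> #|im w| = #|V| by move=> wG; rewrite card_imset //; exact: Ginj.
pose P0 := random_subset_prob p (fun S => forall w, w \in G -> ~~ (im w \subset S)).
have : 1 - P0 <= random_subset_prob p (fun S => exists2 w : {ffun 'I_n -> D},
    injective (type_map typ w) & forall v, type_map typ w v \in S).
  rewrite -random_subset_prob_not; apply: random_subset_prob_le => // S.
  move=> /existsNP[w /not_implyP[wG /negP]]; rewrite negbK => /fintype.subsetP wS.
  by exists w; [exact: Ginj | move=> v; apply: wS; exact: imset_f].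
apply: le_trans.
have g0 : 0 < #|G|%:R :> R by rewrite ltr0n.
have N0 : 0 < N.
  apply: (lt_le_trans g0).
  by rewrite /N -natrX ler_nat (leq_trans (max_card (mem G))) // card_ffun card_ord.
have := @random_subset_second_moment R _ _ p G im p01'.
have -> : \sum_(w in G) p ^+ #|im w| = #|G|%:R * p ^+ #|V|.
  rewrite (eq_bigr (fun=> p ^+ #|V|)) => [|w wG]; last by rewrite card_im.
  by rewrite sumr_const mulr_natl.
rewrite -/P0 => h.
have le2 : \sum_(w in G) \sum_(w' in G) p ^+ #|im w :|: im w'| <=
    #|G|%:R * (p ^+ (2 * #|V|) * N * K).
  rewrite exchange_big mulr_natl -sumr_const; apply: ler_sum => w' w'G.
  exact: pairs_sum_le.
move: (le_trans h (lerB le2 (lexx _))).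
rewrite mul2n -addnn exprD; set q := p ^+ #|V|; set g : R := #|G|%:R.
have q0 : 0 < q by rewrite exprn_gt0.
have -> : P0 * (g * q) ^+ 2 = (q * q * g) * (P0 * g) by ring.
have -> : g * (q * q * N * K) - (g * q) ^+ 2 = (q * q * g) * (N * K - g) by ring.
rewrite ler_pM2l ?mulr_gt0 // => {}h.
have : P0 <= (N * K - g) / g by rewrite ler_pdivlMr.
have -> : (N * K - g) / g = K / (g / N) - 1 by field; rewrite !gt_eqF.
by lra.
Qed.

Lemma cvg_sum_geometric (R : realType) (I : finType) (P : pred I) (r : I -> R) :
  (forall i, P i -> 0 <= r i < 1) ->
  (\sum_(i | P i) r i ^+ n @[n --> \oo] --> (0 : R))%classic.
Proof.
move=> rP; elim: (index_enum I) => [|i s IHs].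
  by under eq_fun do rewrite big_nil; exact: cvg_cst.
have [Pi|nPi] := boolP (P i); last first.
  by under eq_fun do rewrite big_cons (negbTE nPi).
under eq_fun do rewrite big_cons Pi.
have h : (r i ^+ n @[n --> \oo] --> (0 : R))%classic.
  by apply: cvg_expr; case/andP: (rP i Pi) => r0 r1; rewrite ger0_norm.
by have := cvgD h IHs; rewrite addr0; exact.
Qed.

Lemma card_type_map_eq (V D : finType) (typ : V -> D -> bool) (n : nat) (v v' : V) :
  #|[set w : {ffun 'I_n -> D} | type_map typ w v == type_map typ w v']| =
  (#|[set j | typ v j == typ v' j]| ^ n)%N.
Proof.
rewrite -[n in RHS]card_ord -card_ffun_on; apply: eq_card => w; rewrite inE.
apply/eqP/ffun_onP => [/finset.setP h i|h].
  by have := h i; rewrite !inE => ->.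
by apply/finset.setP => i; have := h i; rewrite !inE => /eqP.
Qed.

(** Divided by [#|D|], the sum in the last hypothesis is [c' * #|A|] minus the entropy of the
    marginal on [A] of a uniform letter. Separation of the elements makes almost all words
    injective. *)
Lemma type_copy_whp (R : realType) (V D : finType) (typ : V -> D -> bool) (c c' : R) :
  0 <= c -> c < c' -> (0 < #|D|)%N ->
  (forall v v' : V, v != v' -> exists j, typ v j != typ v' j) ->
  (forall A : {set V}, A != finset.set0 ->
    \sum_j (ln (fiber_size typ A j)%:R - ln #|D|%:R + c' * #|A|%:R) < 0 :> R) ->
  whp (fun n : nat => expR (- c * n%:R))
    (fun n S => exists2 w : {ffun 'I_n -> D},
       injective (type_map typ w) & forall v, type_map typ w v \in S).
Proof.
move=> c0 cc' D0 sep ent.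
have dR : 0 < #|D|%:R :> R by rewrite ltr0n.
pose a (A : {set V}) (j : D) : R :=
  ln (fiber_size typ A j)%:R - ln #|D|%:R + c' * #|A|%:R.
have /choice[z zP] : forall A : {set V}, exists z : R, A != finset.set0 ->
    0 <= z < #|D|%:R /\ forall n,
    #|[set w : {ffun 'I_n -> D} | 0 < \sum_(i < n) a A (w i)]|%:R <= z ^+ n.
  move=> A; have [A0|A0] := eqVneq A finset.set0; first by exists 0.
  have [s s0 sD] := chernoff_exponent (ent A A0).
  exists (\sum_j expR (s * a A j)) => _; split; last by move=> n; exact: card_positive_sum.
  by rewrite sD andbT; apply: sumr_ge0 => j _; exact: expR_ge0.
pose m (v v' : V) := #|[set j | typ v j == typ v' j]|.
have mD v v' : v != v' -> (m v v' < #|D|)%N.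
  move=> /sep[j vj]; rewrite /m -cardsT; apply: proper_card.
  by apply/fintype.properP; split; [exact: finset.subsetT | exists j; rewrite !inE // (negbTE vj)].
(* Good words are injective and typical for every nonempty [A]; the others form a fraction at most
   [delta n], a finite sum of decaying geometric terms. *)
pose good n (w : {ffun 'I_n -> D}) := injectiveb (type_map typ w) &&
  [forall A : {set V}, (A != finset.set0) ==> (\sum_(i < n) a A (w i) <= 0)].
pose G n := [set w : {ffun 'I_n -> D} | good n w].
pose g n : R := #|G n|%:R / #|D|%:R ^+ n.
pose delta n : R := \sum_(A : {set V} | A != finset.set0) (z A / #|D|%:R) ^+ n +
  \sum_(vv : V * V | vv.1 != vv.2) ((m vv.1 vv.2)%:R / #|D|%:R) ^+ n.
have g_ge n : 1 - delta n <= g n.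
  have N0 : 0 < #|D|%:R ^+ n :> R by rewrite exprn_gt0.
  rewrite lerBlDl -lerBlDr.
  have -> : 1 - g n = #|~: G n|%:R / #|D|%:R ^+ n.
    have e : #|G n|%:R + #|~: G n|%:R = #|D|%:R ^+ n :> R.
      by rewrite -natrD finset.cardsC card_ffun card_ord natrX.
    by rewrite /g -e; field; rewrite e gt_eqF.
  have -> : delta n = (\sum_(A : {set V} | A != finset.set0) z A ^+ n +
     \sum_(vv : V * V | vv.1 != vv.2) (m vv.1 vv.2)%:R ^+ n) / #|D|%:R ^+ n.
    by rewrite mulrDl !mulr_suml; congr (_ + _); apply: eq_bigr => i _; rewrite expr_div_n.
  rewrite ler_pM2r ?invr_gt0 //.
  pose B1 A := [set w : {ffun 'I_n -> D} | 0 < \sum_(i < n) a A (w i)].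
  pose B2 (vv : V * V) := [set w : {ffun 'I_n -> D} | type_map typ w vv.1 == type_map typ w vv.2].
  apply: (@le_trans _ _ (\sum_(A : {set V} | A != finset.set0) #|B1 A|%:R +
     \sum_(vv : V * V | vv.1 != vv.2) #|B2 vv|%:R)); last first.
    apply: lerD; apply: ler_sum; first by move=> A /zP[_]; exact.
    by move=> vv _; rewrite /B2 card_type_map_eq natrX.
  rewrite -sum1_card natr_sum [leLHS]big_mkcond /=.
  under [X in _ <= X + _]eq_bigr do rewrite -sum1_card natr_sum big_mkcond /=.
  under [X in _ <= _ + X]eq_bigr do rewrite -sum1_card natr_sum big_mkcond /=.
  rewrite exchange_big [X in _ <= _ + X]exchange_big -big_split /=.
  apply: ler_sum => w _.
  have s1 : 0 <= \sum_(A : {set V} | A != finset.set0) (if w \in B1 A then 1 else 0) :> R.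
    by apply: sumr_ge0 => A _; case: ifP.
  have s2 : 0 <= \sum_(vv : V * V | vv.1 != vv.2) (if w \in B2 vv then 1 else 0) :> R.
    by apply: sumr_ge0 => A _; case: ifP.
  case: ifP => [|_]; last by rewrite addr_ge0.
  rewrite !inE /good negb_and => /orP[/injectivePn[v [v' vv' e]]|/forallPn[A]].
    rewrite addrC (bigD1 (v, v')) //= inE e eqxx -addrA lerDl addr_ge0 //.
    by apply: sumr_ge0 => A _; case: ifP.
  rewrite negb_imply -ltNge => /andP[A0 Aw].
  rewrite (bigD1 A) //= inE Aw -addrA lerDl addr_ge0 //.
  by apply: sumr_ge0 => B _; case: ifP.
have g_le n : g n <= 1.
  rewrite ler_pdivrMr ?exprn_gt0 // mul1r -natrX ler_nat.
  by rewrite (leq_trans (max_card (mem (G n)))) // card_ffun card_ord.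
have delta0 : (delta n @[n --> \oo] --> (0 : R))%classic.
  rewrite -[X in (_ --> X)%classic]addr0; apply: cvgD; apply: cvg_sum_geometric.
    move=> A /zP[/andP[z0 zD] _].
    by rewrite divr_ge0 ?(ltW dR) //= ltr_pdivrMr // mul1r.
  by move=> vv /mD h; rewrite divr_ge0 //= ltr_pdivrMr // mul1r ltr_nat.
have g1 : (g n @[n --> \oo] --> (1 : R))%classic.
  apply: (@squeeze_cvgr _ _ _ _ (fun n => 1 - delta n) (fun=> 1)).
  - by near=> n; rewrite g_ge g_le.
  - by rewrite -[X in (_ --> X)%classic]subr0; apply: cvgB => //; exact: cvg_cst.
  - exact: cvg_cst.
pose eps n := expR (c - c') ^+ n.
have eps0 : (eps n @[n --> \oo] --> (0 : R))%classic.
  by apply: cvg_expr; rewrite ger0_norm ?expR_ge0 // -[ltRHS]expR0 ltr_expR subr_lt0.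
pose K : R := #|{: {set V} * {ffun V -> V}}|%:R.
pose f n := 2 - (1 + K * eps n) / g n.
have f1 : (f n @[n --> \oo] --> (1 : R))%classic.
  rewrite (_ : 1 = 2 - (1 + K * 0) / 1); last by field.
  apply: cvgB; first exact: cvg_cst.
  apply: cvgM; last by apply: cvgV => //; exact: oner_neq0.
  by apply: cvgD; [exact: cvg_cst | apply: cvgM => //; exact: cvg_cst].
rewrite /whp; apply: (@squeeze_cvgr _ _ _ _ f (fun=> 1)) => //; last exact: cvg_cst.
near=> n.
have gn : 0 < g n by near: n; apply: (cvgr_gt _ g1).
have p01 : 0 < expR (- c * n%:R) <= 1.
  by rewrite expR_gt0 /= -[leRHS]expR0 ler_expR mulNr oppr_le0 mulr_ge0.
have p01' : 0 <= expR (- c * n%:R) <= 1 by rewrite expR_ge0; case/andP: p01.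
apply/andP; split; last first.
  rewrite -[leRHS](@random_subset_prob_total R {set 'I_n} (expR (- c * n%:R))).
  exact: random_subset_prob_le.
apply: (@type_copy_prob_ge R V D typ n _ (eps n) (G n)) => //.
- by rewrite exprn_ge0 ?expR_ge0.
- by move=> w; rewrite inE => /andP[/injectiveP].
- move=> A w A0; rewrite inE => /andP[_ /forallP/(_ A)]; rewrite A0 /= => le0.
  have fp j : 0 < (fiber_size typ A j)%:R :> R.
    by rewrite ltr0n; apply/card_gt0P; exists j; rewrite inE; apply/forall_inP.
  rewrite natr_prod.
  have -> : \prod_(i < n) (fiber_size typ A (w i))%:R =
      expR (\sum_(i < n) ln (fiber_size typ A (w i))%:R) :> R.
    by rewrite expR_sum; apply: eq_bigr => i _; rewrite lnK ?posrE.
  have -> : #|D|%:R ^+ n = expR (n%:R * ln #|D|%:R) :> R.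
    by rewrite expRM_natl lnK ?posrE.
  rewrite /eps -!expRM_natl -!expRD ler_expR.
  have sc (x : R) : \sum_(i < n) x = n%:R * x by rewrite sumr_const card_ord mulr_natl.
  move: le0; rewrite big_split /= sumrB !sc => le0.
  have A1 : (1 <= #|A|)%N by rewrite card_gt0.
  (* Typicality gains [expR ((c - c') * n)] once for each element of [A]; since [A] is nonempty,
     this is at most [eps n]. *)
  have : 0 <= n%:R * (c' - c) * (#|A|%:R - 1).
    rewrite mulr_ge0 ?mulr_ge0 ?subr_ge0 //; first exact: ltW.
    by rewrite ler1n.
  by set x := n%:R in le0 *; set y := #|A|%:R in le0 *; lra.
- by rewrite -(ltr_nat R); move: gn; rewrite /g pmulr_lgt0 ?invr_gt0 ?exprn_gt0.
Unshelve. all: by end_near.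
Qed.

(** * A Ramsey poset with 13 elements *)

(* The elements [x a b u d e y p q r P Q R] are numbered 0 to 12 in this order. *)
Definition covers : seq (nat * nat) :=
  [:: (0, 1); (0, 2); (1, 3); (2, 3); (3, 4); (3, 5); (4, 6); (5, 6);
      (0, 7); (7, 8); (7, 9); (8, 4); (9, 4);
      (1, 10); (1, 11); (10, 12); (11, 12); (12, 6)]%N.

Fixpoint bitseqs (n : nat) : seq bitseq :=
  if n is n'.+1 then
    [seq true :: s | s <- bitseqs n'] ++ [seq false :: s | s <- bitseqs n']
  else [:: [::]].

Definition bit (t : bitseq) (v : nat) : bool := nth false t v.

(* The weights approximate the distribution on up-sets maximizing the least ratio of the
   entropy of a marginal to its number of elements. The two tests are whether the
   coordinate lies in [d] but not in [x], and in [y] but not in [a]. *)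
Definition multiplicity (t : bitseq) : nat :=
  match bit t 4 && ~~ bit t 0, bit t 6 && ~~ bit t 1 with
  | true, true => 1
  | true, false => if bit t 7 then 5 else 3
  | false, true => if bit t 12 then 3 else 5
  | false, false => 23
  end%N.

(** Up-sets are repeated according to their weights, which turns the weighted distribution into a
    uniform draw of a letter. *)
Definition sample : seq bitseq :=
  flatten [seq nseq (multiplicity t) t | t <- bitseqs 13 &
             all (fun c => bit t c.1 ==> bit t c.2) covers].

(* Entry [m > 0] is an upper bound of [1000 * ln m]. *)
Definition ln_table : seq N :=
  [::
     0; 0; 694; 1099; 1387; 1610; 1792; 1946; 2080; 2198; 2303; 2398; 2485;
     2565; 2640; 2709; 2773; 2834; 2891; 2945; 2996; 3045; 3092; 3136; 3179;
     3219; 3259; 3296; 3333; 3368; 3402; 3435; 3466; 3497; 3527; 3556; 3584;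
     3611; 3638; 3664; 3689; 3714; 3738; 3762; 3785; 3807; 3829; 3851; 3872;
     3892; 3913; 3932; 3952; 3971; 3990; 4008; 4026; 4044; 4061; 4078; 4095;
     4111; 4128; 4144; 4159; 4175; 4190; 4205; 4220; 4235; 4249; 4263; 4277;
     4291; 4305; 4318; 4331; 4344; 4357; 4370; 4383; 4395; 4407; 4419; 4431;
     4443; 4455; 4466; 4478; 4489; 4500; 4511; 4522; 4533; 4544; 4554; 4565;
     4575; 4586; 4596; 4606; 4616; 4626; 4635; 4645; 4655; 4664; 4673; 4683;
     4692; 4701; 4710; 4719; 4728; 4737; 4745; 4754; 4763; 4771; 4780; 4788;
     4796; 4805; 4813; 4821; 4829; 4837; 4845; 4853; 4860; 4868; 4876; 4883;
     4891; 4898; 4906; 4913; 4921; 4928; 4935; 4942; 4949; 4956; 4963; 4970;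
     4977; 4984; 4991; 4998; 5004; 5011; 5018; 5024; 5031; 5038; 5044; 5050;
     5057; 5063; 5069; 5076; 5082; 5088; 5094; 5100; 5106; 5113; 5119; 5125;
     5130; 5136; 5142; 5148; 5154; 5160; 5165; 5171; 5177; 5182; 5188; 5194;
     5199; 5205; 5210; 5215; 5221; 5226; 5232; 5237; 5242; 5248; 5253; 5258;
     5263; 5268; 5274; 5279; 5284; 5289; 5294; 5299; 5304; 5309; 5314; 5319;
     5324; 5328; 5333; 5338; 5343; 5348; 5352; 5357; 5362; 5367]%num.

Definition ln_bound (m : nat) : Z := Z.of_N (nth N0 ln_table m).

Fixpoint zsum (s : seq Z) : Z := if s is z :: s' then Z.add z (zsum s') else Z0.

(* The inequality [H(A) > 0.3251 * k] for a set [A] of [k] elements, where [gs] are the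
   classes of the sample points that agree on [A]. *)
Definition entropy_leaf (gs : seq (seq bitseq)) (k : Z) : bool :=
  Z.eqb k 0 ||
  all (fun g => size g < 215)%N gs &&
  Z.ltb (Z.add (Z.mul 10 (zsum [seq Z.mul (Z.of_nat (size g)) (ln_bound (size g)) | g <- gs]))
               (Z.mul k (214 * 3251)))
        (214 * 53650).

(** Points lose their head bit, so the next element to decide is always at the head. Empty classes
    have cost 0 and are dropped. *)
Definition split_groups (gs : seq (seq bitseq)) : seq (seq bitseq) :=
  flatten [seq [seq g' <- [:: [seq behead t | t <- g & head false t];
                              [seq behead t | t <- g & ~~ head false t]] | g' != [::]] | g <- gs].

(* Runs through all sets [A], deciding for each element in turn whether it is in [A];
   the classes of agreeing points are refined along the way. *)
Fixpoint entropy_check (n : nat) (gs : seq (seq bitseq)) (k : Z) : bool :=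
  if n is n'.+1 then
    entropy_check n' [seq [seq behead t | t <- g] | g <- gs] k &&
    entropy_check n' (split_groups gs) (Z.succ k)
  else entropy_leaf gs k.

(* Every 2-colouring makes one of these diamonds monochromatic, and none of them can be
   left out. *)
Definition diamonds : seq (nat * nat * nat * nat) :=
  [:: (0, 1, 2, 3); (0, 1, 2, 5); (0, 1, 3, 5); (0, 1, 4, 6); (0, 1, 7, 4);
      (0, 1, 7, 6); (0, 1, 8, 4); (0, 1, 8, 6); (0, 1, 9, 4); (0, 1, 9, 6);
      (0, 3, 7, 4); (0, 3, 8, 4); (0, 3, 9, 4); (0, 4, 10, 6); (0, 4, 11, 6);
      (0, 4, 12, 6); (0, 7, 10, 6); (0, 7, 11, 6); (0, 7, 12, 6); (0, 8, 10, 6);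
      (0, 8, 11, 6); (0, 8, 12, 6); (0, 9, 10, 6); (0, 9, 11, 6); (0, 9, 12, 6);
      (0, 10, 11, 12); (1, 3, 10, 6); (1, 3, 11, 6); (1, 3, 12, 6); (1, 4, 10, 6);
      (1, 4, 11, 6); (1, 4, 12, 6); (1, 10, 11, 12); (2, 3, 4, 6); (2, 4, 5, 6);
      (3, 4, 5, 6); (7, 8, 9, 4); (7, 8, 9, 6)]%N.

Definition monochromatic (s : bitseq) (q : nat * nat * nat * nat) : bool :=
  let: (x, a, b, y) := q in
  [&& bit s a == bit s x, bit s b == bit s x & bit s y == bit s x].

(** This relation forces inclusion of the images for every word over the sample. *)
Definition sample_le (v w : nat) : bool := all (fun t => bit t v ==> bit t w) sample.

Lemma size_sample : size sample = 214%N.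
Proof. by vm_compute. Qed.

Lemma ln_table_checked :
  all (fun m => exp_lower_check (Z.pow 2 44) 18 (ln_bound m) 1000 (Z.of_nat m) (Z.of_nat 1))
    (iota 1 214).
Proof. by vm_compute. Qed.

Lemma sample_entropy_checked : entropy_check 13 [:: sample] 0.
Proof. by vm_compute. Qed.

Lemma monochromatic_checked : all (fun s => has (monochromatic s) diamonds) (bitseqs 13).
Proof. by vm_compute. Qed.

Lemma diamonds_checked :
  all (fun q : nat * nat * nat * nat => let: (x, a, b, y) := q in
    [&& uniq [:: x; a; b; y], (y < 13)%N, (x < 13)%N, (a < 13)%N, (b < 13)%N,
     sample_le x a, sample_le x b, sample_le a y & sample_le b y])
    diamonds.
Proof. by vm_compute. Qed.

Lemma sample_separated :
  all (fun v => all (fun w => (v == w) || has (fun t => bit t v != bit t w) sample)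
    (iota 0 13)) (iota 0 13).
Proof. by vm_compute. Qed.

(** * Soundness of the entropy computation *)

Fixpoint agree (m t t' : bitseq) : bool :=
  if m is b :: m' then (b ==> (head false t == head false t')) && agree m' (behead t) (behead t')
  else true.

(** For the whole sample, [ln 214] minus this cost over 214 is the entropy of the marginal on the
    elements marked in [m]. *)
Definition log_cost (R : realType) (m : bitseq) (g : seq bitseq) : R :=
  \sum_(t <- g) ln (count (agree m t) g)%:R.

Lemma log_cost_skip (R : realType) (m : bitseq) (g : seq bitseq) :
  log_cost R (false :: m) g = log_cost R m [seq behead t | t <- g].
Proof. by rewrite /log_cost big_map; under [RHS]eq_bigr do rewrite count_map. Qed.

(** Points with different head bits never agree, so each class size is counted within one half. *)
Lemma log_cost_split (R : realType) (m : bitseq) (g : seq bitseq) :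
  log_cost R (true :: m) g = log_cost R m [seq behead t | t <- g & head false t] +
    log_cost R m [seq behead t | t <- g & ~~ head false t].
Proof.
rewrite /log_cost !big_map !big_filter (bigID (head false)) /=.
congr (_ + _); apply: eq_bigr => t ht; congr (ln _%:R); rewrite count_map count_filter;
  apply: eq_count => t'; move: ht; rewrite /= andbC.
  by move=> ->; case: (head false t').
by move=> /negbTE ->; case: (head false t').
Qed.

Lemma log_cost_base (R : realType) (g : seq bitseq) :
  log_cost R [::] g = (size g)%:R * ln (size g)%:R.
Proof.
rewrite /log_cost (eq_bigr (fun=> ln (size g)%:R)).
  by rewrite big_const_seq count_predT iter_addr_0 mulr_natl.
by move=> t _; rewrite (@eq_count _ _ predT) ?count_predT.
Qed.

Lemma ln_bound_checked (m : nat) : (0 < m < 215)%N ->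
  exp_lower_check (Z.pow 2 44) 18 (ln_bound m) 1000 (Z.of_nat m) (Z.of_nat 1).
Proof.
move=> m_int; have := allP ln_table_checked m; apply.
by rewrite mem_iota.
Qed.

Lemma ln_le_bound (R : realType) (m : nat) :
  (0 < m < 215)%N -> ln m%:R <= ZtoR R (ln_bound m) / ZtoR R 1000.
Proof.
move=> m_int; have := @exp_lower_checkP R _ _ _ _ _ _ (ln_bound_checked m_int).
rewrite !ZtoR_nat divr1 => h.
have m0 : 0 < m%:R :> R by rewrite ltr0n; case/andP: m_int.
by rewrite -ler_expR lnK.
Qed.

Lemma ln214_checked :
  exp_lower_check (Z.pow 2 44) 18 (Z.mul (-1) 5365) 1000 (Z.of_nat 1) (Z.of_nat 214).
Proof. by vm_compute. Qed.

Lemma ln214_ge (R : realType) : ZtoR R 5365 / ZtoR R 1000 <= ln 214%:R.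
Proof.
have p0 : 0 < 214%:R :> R by rewrite ltr0n.
rewrite -ler_expR lnK; last exact: p0.
apply: expR_le_inv; first exact: p0.
apply: (@exp_lower_check_ge R _ _ _ _ _ _ _ _ ln214_checked).
  rewrite ZtoRM (_ : ZtoR R (-1) = -1) // mulNr divfK ?mulN1r //.
  by rewrite gt_eqF // -[0]/(ZtoR R 0) ZtoR_lt.
by rewrite !ZtoR_nat mulVf; [by [] | rewrite gt_eqF].
Qed.

Lemma sum_log_cost_skip (R : realType) (m : bitseq) (gs : seq (seq bitseq)) :
  \sum_(g <- gs) log_cost R (false :: m) g =
  \sum_(g <- [seq [seq behead t | t <- g] | g <- gs]) log_cost R m g.
Proof. by rewrite big_map; apply: eq_bigr => g _; exact: log_cost_skip. Qed.

Lemma sum_log_cost_split (R : realType) (m : bitseq) (gs : seq (seq bitseq)) :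
  \sum_(g <- gs) log_cost R (true :: m) g =
  \sum_(g <- split_groups gs) log_cost R m g.
Proof.
rewrite big_flatten big_map; apply: eq_bigr => g _; rewrite log_cost_split big_filter.
rewrite big_mkcond !big_cons big_nil. rewrite Monoid.mulm1.
have drop0 g' : (if g' != [::] then log_cost R m g' else 0) = log_cost R m g'.
  by case: eqP => // ->; rewrite /log_cost big_nil.
by rewrite !drop0.
Qed.

Lemma ZtoR_zsum (R : realType) (s : seq Z) : ZtoR R (zsum s) = \sum_(z <- s) ZtoR R z.
Proof. by elim: s => [|z s IHs]; rewrite ?big_nil // big_cons -IHs -ZtoRD. Qed.

(** Here [k] counts the elements already put in the set and [m] marks the choices still to come.
    Positivity excludes the empty set, which the leaf test lets through. *)
Lemma entropy_checkP (R : realType) (m : bitseq) (gs : seq (seq bitseq)) (k : nat) :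
  entropy_check (size m) gs (Z.of_nat k) -> (0 < k + count id m)%N ->
  \sum_(g <- gs) log_cost R m g + 214%:R * (ZtoR R 3251 / ZtoR R 10000 * (k + count id m)%:R) <
  214%:R * (ZtoR R 5365 / ZtoR R 1000).
Proof.
elim: m gs k => [|b m IHm] gs k /=; last first.
  case/andP => skip split; case: b => [|]; last first.
    by rewrite sum_log_cost_skip; exact: IHm.
  rewrite sum_log_cost_split addnA addn1; apply: IHm.
  by rewrite Nat2Z.inj_succ.
rewrite addn0 /entropy_leaf => /orP[/Z.eqb_eq/(Nat2Z.inj _ 0) ->|/andP[small lt] _] //.
have cost_le : \sum_(g <- gs) log_cost R [::] g <=
    ZtoR R (zsum [seq Z.mul (Z.of_nat (size g)) (ln_bound (size g)) | g <- gs]) / ZtoR R 1000.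
  rewrite ZtoR_zsum big_map mulr_suml !big_seq; apply: ler_sum => g /(allP small) g_small.
  rewrite log_cost_base ZtoRM ZtoR_nat -mulrA; apply: ler_wpM2l => //.
  (* For an empty class, [ln 0 = 0] by convention, matching entry 0 of the table. *)
  have [->|g0] := posnP (size g).
    by rewrite ln0 // -[ZtoR R (ln_bound 0)]/(0 : R) mul0r.
  by apply: ln_le_bound; rewrite g0.
move: lt; rewrite -(ZtoR_lt R) !(ZtoRD, ZtoRM) ZtoR_nat => lt.
apply: (le_lt_trans (lerD cost_le (lexx _))).
have e10 : ZtoR R 10 = 10 by rewrite /ZtoR; ring.
have e214 : ZtoR R 214 = 214%:R by rewrite /ZtoR; ring.
have e1000 : ZtoR R 1000 = 1000%:R by rewrite /ZtoR; ring.
have e3251 : ZtoR R 3251 = 3251%:R by rewrite /ZtoR; ring.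
have e5365 : ZtoR R 5365 = 5365%:R by rewrite /ZtoR; ring.
have e10000 : ZtoR R 10000 = 10000%:R by rewrite /ZtoR; ring.
have e53650 : ZtoR R 53650 = 53650%:R by rewrite /ZtoR; ring.
move: lt; rewrite e10 e214 e1000 e3251 e5365 e10000 e53650.
set z := ZtoR R _; set kk := k%:R; clear; lra.
Qed.

Lemma agreeP (m t t' : bitseq) :
  reflect (forall v, bit m v -> bit t v = bit t' v) (agree m t t').
Proof.
elim: m t t' => [|b m IHm] t t' /=; first by apply: ReflectT => v; rewrite /bit nth_nil.
have bitS (s : bitseq) v : bit (behead s) v = bit s v.+1 by case: s => [|? ?] //; rewrite /bit !nth_nil.
have bit0 (s : bitseq) : head false s = bit s 0 by case: s.
apply: (iffP andP) => [[hd /IHm tl] [|v]|h].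
- by rewrite /bit /= -/(bit t 0) -/(bit t' 0) -!bit0 => b1; move: hd; rewrite b1 => /eqP.
- by move=> bv; rewrite -!bitS; exact: tl.
split; last by apply/IHm => v bv; rewrite !bitS; exact: (h v.+1).
by apply/implyP => b1; rewrite !bit0 (h 0%N).
Qed.

Definition sample_type (v : 'I_13) (j : 'I_214) : bool := bit (nth [::] sample j) v.

Definition mask (A : {set 'I_13}) : bitseq := [seq v \in A | v <- enum 'I_13].

Lemma bit_mask (A : {set 'I_13}) (v : 'I_13) : bit (mask A) v = (v \in A).
Proof. by rewrite /bit (nth_map v) ?size_enum_ord // nth_ord_enum. Qed.

Lemma size_mask (A : {set 'I_13}) : size (mask A) = 13%N.
Proof. by rewrite size_map size_enum_ord. Qed.

Lemma count_mask (A : {set 'I_13}) : count id (mask A) = #|A|.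
Proof. by rewrite count_map enumT cardE /enum_mem size_filter; apply: eq_count. Qed.

Lemma fiber_size_sample (A : {set 'I_13}) (j : 'I_214) :
  fiber_size sample_type A j = count (agree (mask A) (nth [::] sample j)) sample.
Proof.
rewrite -sum1_count (big_nth [::]) size_sample big_mkord sum1_card /fiber_size.
apply: eq_card => k; rewrite !inE; apply/forall_inP/agreeP => [h v|h v vA].
  move=> mv; have v13 : (v < 13)%N.
    by rewrite ltnNge; apply: contraL mv => v13; rewrite /bit nth_default ?size_mask.
  rewrite -[v]/(val (Ordinal v13)) bit_mask in mv *.
  by have /eqP := h _ mv.
by rewrite /sample_type (h v) ?bit_mask.
Qed.

Lemma sample_entropy (R : realType) (A : {set 'I_13}) : A != finset.set0 ->
  \sum_j (ln (fiber_size sample_type A j)%:R - ln #|'I_214|%:R +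
     ZtoR R 3251 / ZtoR R 10000 * #|A|%:R) < 0 :> R.
Proof.
rewrite -card_gt0 => A0; rewrite big_split sumrB /= !sumr_const card_ord.
have e : \sum_j ln (fiber_size sample_type A j)%:R = log_cost R (mask A) sample.
  rewrite /log_cost (big_nth [::]) size_sample big_mkord.
  by apply: eq_bigr => j _; rewrite fiber_size_sample.
have := @entropy_checkP R (mask A) [:: sample] 0.
rewrite size_mask count_mask add0n => /(_ sample_entropy_checked A0).
rewrite big_seq1 -e; have := ln214_ge R.
rewrite -[_ *+ 214]mulr_natl -[X in _ - _ + X < _]mulr_natl.
set x := \sum_j _; set l := ln _; set a := #|A|%:R.
move: (ZtoR R 3251 / ZtoR R 10000) (ZtoR R 5365 / ZtoR R 1000) => b d; clear; lra.
Qed.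

(** * Monochromatic diamonds in copies of the 13-element poset *)

Lemma diamond_copy_of d (P : porderType d) (x a b y : P) :
  uniq [:: x; a; b; y] -> (x <= a)%O -> (x <= b)%O -> (a <= y)%O -> (b <= y)%O ->
  exists2 phi : {set 'I_2} -> P, is_copy phi & forall A, phi A \in [:: x; a; b; y].
Proof.
rewrite /= !inE !negb_or => /andP[/and3P[xa xb xy] /andP[/andP[ab ay] /andP[by_ _]]].
move=> lexa lexb leay leby; have lexy := le_trans lexa leay.
(* The memberships of the two points of ['I_2] select the corner. *)
pose phi (A : {set 'I_2}) :=
  if ord0 \in A then if ord_max \in A then y else a else if ord_max \in A then b else x.
exists phi; last by move=> A; rewrite /phi !inE; do 2!case: ifP => _; rewrite eqxx ?orbT.
split=> [A B|A B AB]; last first.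
  have := fintype.subsetP AB ord0; have := fintype.subsetP AB ord_max; rewrite /phi.
  by do 4!case: ifP => _ //; do ?[move=> /(_ isT) //|move=> _].
move=> eAB; have [e0 e1] : (ord0 \in A) = (ord0 \in B) /\ (ord_max \in A) = (ord_max \in B).
  move: eAB xa xb xy ab ay by_; rewrite /phi; do 4!case: ifP => _ //;
    by move=> ->; rewrite eqxx.
apply/finset.setP => i; case: (ord0 =P i) => [<- //|i0].
suff -> : i = ord_max by [].
by apply/val_inj; case: i i0 => -[|[|]] // lt0 i0; case: i0; apply/val_inj.
Qed.

Lemma mem_bitseqs (s : bitseq) : s \in bitseqs (size s).
Proof.
elim: s => //= b s IHs; rewrite mem_cat.
by case: b; [rewrite map_f | rewrite map_f ?orbT].
Qed.

Lemma sample_le_type_map (n : nat) (w : {ffun 'I_n -> 'I_214}) (v v' : 'I_13) :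
  sample_le v v' -> type_map sample_type w v \subset type_map sample_type w v'.
Proof.
move=> /allP le; apply/fintype.subsetP => i; rewrite !inE => vi.
have /le : nth [::] sample (w i) \in sample by rewrite mem_nth // size_sample.
by rewrite -[bit _ v]/(sample_type v (w i)) vi.
Qed.

(** A colouring of the copy is one of the bit sequences of length 13 checked exhaustively;
    injectivity keeps the corners of the diamond found distinct. *)
Lemma sample_copy_ramsey (n : nat) (S : {set {set 'I_n}}) (w : {ffun 'I_n -> 'I_214}) :
  injective (type_map sample_type w) -> (forall v, type_map sample_type w v \in S) ->
  ramsey {set 'I_2} (subposet S) 2.
Proof.
move=> winj wS chi; pose el v : subposet S := exist _ (type_map sample_type w v) (wS v).
pose s := [seq chi (el v) == ord0 | v <- enum 'I_13].
have s13 : size s = 13%N by rewrite size_map size_enum_ord.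
have bit_s (v : 'I_13) : bit s v = (chi (el v) == ord0).
  by rewrite /bit (nth_map v) ?size_enum_ord // nth_ord_enum.
have /(allP monochromatic_checked) : s \in bitseqs 13 by rewrite -s13 mem_bitseqs.
case/hasP=> -[[[x a] b] y] /(allP diamonds_checked).
case/andP=> us /and5P[y13 x13 a13 b13 /and4P[xa xb ay by_]] /and3P[sa sb sy].
pose X := Ordinal x13; pose A := Ordinal a13; pose B := Ordinal b13; pose Y := Ordinal y13.
have chi_eq (v v' : 'I_13) : bit s v == bit s v' -> chi (el v) = chi (el v').
  rewrite !bit_s; case: (chi (el v)) (chi (el v')) => -[|[|]] // lt1 [[|[|]] //] lt2 _;
    exact: val_inj.
have el_inj : injective el by move=> v v' /(congr1 val) /winj.
have el_le (v v' : 'I_13) : sample_le v v' -> (el v <= el v')%O.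
  by move=> /(sample_le_type_map w).
have [phi phiC phi_in] : exists2 phi : {set 'I_2} -> subposet S, is_copy phi &
    forall C, phi C \in [:: el X; el A; el B; el Y].
  apply: diamond_copy_of; [|exact: el_le|exact: el_le|exact: el_le|exact: el_le].
  rewrite -[X in uniq X]/[seq el v | v <- [:: X; A; B; Y]] (map_inj_uniq el_inj).
  by rewrite -(@map_inj_uniq _ _ (@nat_of_ord 13) (@ord_inj 13)).
exists phi => //; exists (chi (el X)) => C.
have := phi_in C; rewrite !inE => /or4P[] /eqP -> //.
- exact: (chi_eq A X sa).
- exact: (chi_eq B X sb).
- exact: (chi_eq Y X sy).
Qed.

Lemma ramsey_whp (R : realType) (c : R) :
  0 <= c -> c < decimal R [:: 3; 2; 5; 0; 1; 2; 1; 3; 2; 6]%N ->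
  whp (fun n : nat => expR (- c * n%:R))
       (fun n S => ramsey {set 'I_2} (subposet S) 2).
Proof.
move=> c0 c1.
(* The sample certifies the rate [0.3251], slightly above the required constant; it serves as
   [c']. *)
have cc' : c < ZtoR R 3251 / ZtoR R 10000.
  apply: (lt_trans c1).
  have -> : ZtoR R 3251 = 3251%:R by rewrite /ZtoR; ring.
  have -> : ZtoR R 10000 = 10000%:R by rewrite /ZtoR; ring.
  by rewrite /decimal /foldr; lra.
have sep (v v' : 'I_13) : v != v' -> exists j, sample_type v j != sample_type v' j.
  move=> vv'; have vI : val v \in iota 0 13 by rewrite mem_iota ltn_ord.
  have v'I : val v' \in iota 0 13 by rewrite mem_iota ltn_ord.
  have := allP (allP sample_separated _ vI) _ v'I.
  rewrite (inj_eq val_inj) (negbTE vv') orFb => /hasP[t /(nthP [::]) tS ne].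
  case: tS => j; rewrite size_sample => j214 tE; exists (Ordinal j214).
  by rewrite /sample_type tE.
have D0 : (0 < #|'I_214|)%N by rewrite card_ord.
have copies := type_copy_whp c0 cc' D0 sep (@sample_entropy R).
rewrite /whp; apply: (@squeeze_cvgr _ _ _ _ _ (fun=> 1) _ _ _ copies); last exact: cvg_cst.
near=> n.
have p01 : 0 <= expR (- c * n%:R) <= 1.
  by rewrite expR_ge0 /= -[leRHS]expR0 ler_expR mulNr oppr_le0 mulr_ge0.
apply/andP; split.
  by apply: random_subset_prob_le => // S [w winj wS]; exact: sample_copy_ramsey winj wS.
rewrite -[leRHS](@random_subset_prob_total R {set 'I_n} (expR (- c * n%:R))).
exact: random_subset_prob_le.
Unshelve. all: by end_near.
Qed.

Unset Implicit Arguments.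

Theorem theorem2 (R : realType) :
  (forall c : R, 0 <= c -> c < decimal R [:: 3; 2; 5; 0; 1; 2; 1; 3; 2; 6]%N ->
     whp (fun n : nat => expR (- c * n%:R))
       (fun n S => ramsey {set 'I_2} (subposet S) 2))
  /\
  (forall c : R, decimal R [:: 3; 2; 8; 9; 0; 3; 7; 3; 9; 1]%N < c ->
     whp (fun n : nat => expR (- c * n%:R))
       (fun n S => ~ ramsey {set 'I_2} (subposet S) 2)).
Proof.
by split=> [c c0 c1|c c1]; [exact: ramsey_whp | exact: not_ramsey_whp].
Qed.
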